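(* For an integer $q\ge 1$ let $A,B,C$ be complex vector spaces of dimension $q+1$ with bases $a_0,\dots,a_q$, $b_0,\dots,b_q$, $c_0,\dots,c_q$, and let $$T_{cw,q}=\sum_{j=1}^q \left(a_0\otimes b_j\otimes c_j+a_j\otimes b_0\otimes c_j+a_j\otimes b_j\otimes c_0\right)\in A\otimes B\otimes C.$$ Then for all $q>2$, $\underline{\mathbf{R}}(T_{cw,q}^{\boxtimes 2})=(q+2)^2$, and $15\le \underline{\mathbf{R}}(T_{cw,2}^{\boxtimes 2})\le 16$.
   Context: A tensor has rank one if it is of the form $a\otimes b\otimes c$. The border rank $\underline{\mathbf{R}}(T)$ of a tensor $T\in A\otimes B\otimes C$ is the smallest $r$ such that $T$ is a limit of a sequence of tensors each of which is a sum of $r$ rank one tensors. For $T\in A\otimes B\otimes C$ and $T'\in A'\otimes B'\otimes C'$, the Kronecker product $T\boxtimes T'$ is $T\otimes T'$ regarded as a 3-way tensor in $(A\otimes A')\otimes(B\otimes B')\otimes(C\otimes C')$; $T^{\boxtimes N}$ denotes the $N$-fold Kronecker power. *)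

(* Defs.v *)
From mathcomp Require Import all_boot all_order all_algebra.
From mathcomp Require Import all_classical all_reals topology normedtype.
From mathcomp Require Import sequences.
From mathcomp Require Export complex.

Set Implicit Arguments.
Unset Strict Implicit.
Unset Printing Implicit Defensive.

Import Order.TTheory GRing.Theory Num.Theory.
Import numFieldNormedType.Exports.

Local Open Scope classical_set_scope.
Local Open Scope ring_scope.

(* For finite types I, J, K indexing fixed bases of A, B, C, a vector of A is
   its family of coordinates I -> R[i], and a tensor in A (x) B (x) C is its
   family of coordinates in the product basis. *)
Notation vect R I := {ffun I -> R[i]}.
Notation tensor R I J K := {ffun I * J * K -> R[i]}.

Definition tprod (R : realType) (I J K : finType)
    (a : vect R I) (b : vect R J) (c : vect R K) : tensor R I J K :=
  [ffun x => a x.1.1 * b x.1.2 * c x.2].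

Definition basis_vect (R : realType) (I : finType) (i : I) : vect R I :=
  [ffun k => (k == i)%:R].

(* The factors may vanish, so 0 also counts; this only turns "sum of r" into
   "sum of at most r" below and does not affect the minimum. *)
Definition rank_one (R : realType) (I J K : finType) (t : tensor R I J K) :=
  exists a b c, t = tprod a b c.

Definition sum_rank_one (R : realType) (I J K : finType) (r : nat)
    (T : tensor R I J K) :=
  exists2 t : 'I_r -> tensor R I J K,
    forall s, rank_one (t s) & T = \sum_(s < r) t s.

(* Convergence in the finite-dimensional space of tensors is coordinatewise;
   ^o selects the topology of R[i] given by its modulus. *)
Definition tensor_cvg (R : realType) (I J K : finType)
    (u : nat -> tensor R I J K) (T : tensor R I J K) :=
  forall x : I * J * K, (fun n => u n x : R[i]^o) @ \oo --> (T x : R[i]^o).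

Definition limit_sum_rank_one (R : realType) (I J K : finType) (r : nat)
    (T : tensor R I J K) :=
  exists2 u : nat -> tensor R I J K,
    forall n, sum_rank_one r (u n) & tensor_cvg u T.

Lemma limit_sum_rank_one_ex (R : realType) (I J K : finType)
  (T : tensor R I J K) : exists r, `[< limit_sum_rank_one r T >].
Proof.
exists #|{: I * J * K}|; apply/asboolP; exists (fun=> T); last first.
  by move=> x; exact: cvg_cst.
pose e := basis_vect R.
move=> _; exists (fun s => let x := enum_val s in
  tprod [ffun i => T x * e I x.1.1 i] (e J x.1.2) (e K x.2)).
  by move=> s /=; do 3!eexists.
apply/ffunP => x; rewrite sum_ffunE (bigD1 (enum_rank x)) //= big1 => [|s sx].
  by rewrite addr0 enum_rankK !ffunE !eqxx !mulr1.
have : x != enum_val s by apply: contra_neq sx => ->; rewrite enum_valK.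
rewrite !ffunE; case: x {sx} (enum_val s) => [[i j] k] [[i' j'] k'] /=.
by rewrite !xpair_eqE; do 3!case: eqP => _ //=; rewrite ?(mulr0, mul0r).
Qed.

Definition border_rank (R : realType) (I J K : finType) (T : tensor R I J K) :
    nat :=
  ex_minn (limit_sum_rank_one_ex T).

(* Coordinates with respect to the product bases of A (x) A', B (x) B' and
   C (x) C'. *)
Definition kron (R : realType) (I J K I' J' K' : finType)
    (T : tensor R I J K) (T' : tensor R I' J' K') :
    tensor R (I * I')%type (J * J')%type (K * K')%type :=
  [ffun x => T (x.1.1.1, x.1.2.1, x.2.1) * T' (x.1.1.2, x.1.2.2, x.2.2)].

(* [lift ord0 j] is the index j + 1, so j : 'I_q ranges over 1, ..., q. *)
Definition Tcw (R : realType) (q : nat) : tensor R 'I_q.+1 'I_q.+1 'I_q.+1 :=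
  let e := @basis_vect R 'I_q.+1 in
  \sum_(j < q) (tprod (e ord0) (e (lift ord0 j)) (e (lift ord0 j))
              + tprod (e (lift ord0 j)) (e ord0) (e (lift ord0 j))
              + tprod (e (lift ord0 j)) (e (lift ord0 j)) (e ord0)).

(* Main.v *)
(* Lower bound: project A (x) A to C^5 and take the Koszul flattening
   Lambda^2 C^5 (x) B^* -> Lambda^3 C^5 (x) C. On a rank one tensor it is
   wedging by a fixed vector of C^5 tensored with a rank one matrix, so it has
   rank at most 6; as rank is lower semicontinuous, a tensor of border rank r
   has a flattening of rank at most 6 r. If the projection only sees the basis
   vectors a_i (x) a_i' with i, i' <= b and q = b + d, the flattening of the
   square of T_cw is block diagonal, with blocks not depending on d: one block
   for the coordinates at most b, 2 d blocks in which one of the two coordinates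
   exceeds b, and d^2 small ones in which both do. For b = 3 an integral
   projection gives blocks of rank at least 145, 30 and 6, and
   145 + 60 d + 6 d^2 > 6 ((d + 5)^2 - 1). For b = 2 and d = 0 the rank is at
   least 85 > 6 * 14. The ranks of the blocks are certified by Gaussian
   elimination.

   Upper bound: T_cw is a limit of tensors of rank at most q + 2, and Kronecker
   products of approximations approximate the Kronecker product. *)

Require Import Defs.
From mathcomp Require Import all_boot all_order all_algebra all_reals.
From mathcomp Require Import all_classical topology normedtype sequences.
From mathcomp Require Import ring zify.

Set Implicit Arguments.
Unset Strict Implicit.
Unset Printing Implicit Defensive.

Import Order.TTheory GRing.Theory Num.Theory.
Import numFieldNormedType.Exports.

Local Open Scope classical_set_scope.
Local Open Scope ring_scope.

(** * Wedge products in C^5 *)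

(** Vectors of C^5 are functions on [nat] read at 0, ..., 4, so that the same formulas can be
    evaluated on integers. *)
Definition unit_vect (F : pzRingType) (m u : nat) : F := (m == u)%:R.

(** The coefficient of e_u /\ e_v /\ e_w in x /\ y /\ z. *)
Definition det3 (F : pzRingType) (x y z : nat -> F) (u v w : nat) : F :=
  x u * (y v * z w - y w * z v) - x v * (y u * z w - y w * z u)
  + x w * (y u * z v - y v * z u).

Lemma eq_det3 (F : pzRingType) (x x' y z : nat -> F) (u v w : nat) :
  x =1 x' -> det3 x y z u v w = det3 x' y z u v w.
Proof. by move=> e; rewrite /det3 !e. Qed.

Lemma det3_intr (F : fieldType) (x y z : nat -> int) (u v w : nat) :
  (det3 x y z u v w)%:~R
  = det3 (fun l => (x l)%:~R) (fun l => (y l)%:~R) (fun l => (z l)%:~R) u v w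
    :> F.
Proof. by rewrite /det3 rmorphD !rmorphB !rmorphM !rmorphB !rmorphM. Qed.

Lemma det3_suml (F : comPzRingType) (I : finType) (a : I -> F)
    (x : I -> nat -> F) (y z : nat -> F) (u v w : nat) :
  det3 (fun l => \sum_i a i * x i l) y z u v w
  = \sum_i a i * det3 (x i) y z u v w.
Proof.
rewrite /det3 !mulr_suml -sumrB -big_split /=.
by apply: eq_bigr => i _; ring.
Qed.

Definition pair4 : seq (nat * nat) :=
  [:: (0, 1); (0, 2); (0, 3); (1, 2); (1, 3); (2, 3)]%N.

(** By bilinearity and alternation the terms with equal indices vanish and those of (i, j) and (j,
    i) merge into a 2 x 2 minor, so only the pairs i < j of [pair4] remain. *)
Lemma det3_span4 (F : comPzRingType) (x : nat -> F) (b : nat -> nat -> F)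
    (c d : nat -> F) (u v w : nat) :
  let p s := nth (0, 0)%N pair4 s in
  det3 x (fun h => \sum_(i < 4) c i * b i h) (fun h => \sum_(i < 4) d i * b i h)
    u v w
  = \sum_(s < 6) (c (p s).1 * d (p s).2 - c (p s).2 * d (p s).1)
                 * det3 x (b (p s).1) (b (p s).2) u v w.
Proof. by rewrite /det3 /= !big_ord_recl !big_ord0 /= /bump /=; ring. Qed.

(* If x l != 0, each e_m is congruent modulo x to a combination of the four
   e_i with i != l, so x /\ e_m /\ e_n lies in the span of the six vectors
   x /\ e_i /\ e_j with i < j both different from l. *)
Lemma wedge_factor (F : fieldType) (x : nat -> F) :
  exists (G : nat -> nat -> 'I_6 -> F) (H : 'I_6 -> nat -> nat -> nat -> F),
  forall m n u v w, (u < 5)%N -> (v < 5)%N -> (w < 5)%N ->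
  det3 x (unit_vect F m) (unit_vect F n) u v w
  = \sum_s G m n s * H s u v w.
Proof.
case: (pickP (fun l : 'I_5 => x l != 0)) => [l xl0|x0]; last first.
  exists (fun _ _ _ => 0), (fun _ _ _ _ => 0) => m n u v w ult vlt wlt.
  have xE k : (k < 5)%N -> x k = 0.
    by move=> klt; have /negbFE/eqP := x0 (Ordinal klt).
  by rewrite /det3 !xE // big1 => [|s _]; ring.
(* [t m] is the multiple of x to subtract from e_m to make coordinate l vanish; [c m] lists the four
   other coordinates, since [bump l] skips l. *)
pose t m := unit_vect F m l / x l.
pose c m i : F := unit_vect F m (bump l i) - t m * x (bump l i).
pose p s := nth (0, 0)%N pair4 s.
exists (fun m n s => c m (p s).1 * c n (p s).2 - c m (p s).2 * c n (p s).1).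
exists (fun s => det3 x (unit_vect F (bump l (p s).1))
                        (unit_vect F (bump l (p s).2))).
move=> m n u v w ult vlt wlt.
pose e m u := unit_vect F m u - t m * x u.
have -> : det3 x (unit_vect F m) (unit_vect F n) u v w
          = det3 x (e m) (e n) u v w.
  by rewrite /det3 /e; ring.
have eE k h : (h < 5)%N ->
    e k h = \sum_(i < 4) c k i * unit_vect F (bump l i) h.
  move=> hlt; rewrite /e; case: (unliftP l (Ordinal hlt)) => [i|] /(congr1 val).
    move=> /= ->; rewrite (bigD1 i) //= big1 => [|i' i'i].
      by rewrite {2}/unit_vect eqxx mulr1 addr0.
    by rewrite /unit_vect (can_eq (@bumpK _)) [val i' == _](negPf i'i) mulr0.
  move=> /= ->; rewrite /t divfK // subrr big1 // => i _.
  by rewrite /unit_vect eq_sym (negPf (neq_bump _ _)) mulr0.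
rewrite /det3 !eE //.
exact: (det3_span4 x (fun i => unit_vect F (bump l i))).
Qed.

(** * Fraction-free elimination *)

(** A row that already starts with 0 is left unscaled, which limits the growth of the entries. *)
Definition elim_row (a : int) (r s : seq int) : seq int :=
  if s is b :: s' then
    if b == 0 then s' else [seq a * x.1 - b * x.2 | x <- zip s' r]
  else [::].

(** Nothing is permuted: the order of rows and columns must itself make each leading entry nonzero
    in turn. *)
Fixpoint eliminable (n : nat) (rows : seq (seq int)) : bool :=
  if n is n'.+1 then
    if rows is (a :: r) :: rows' then
      (a != 0) && eliminable n' [seq elim_row a r s | s <- rows']
    else false
  else true.

(** An eliminated row is a nonzero multiple of the old row minus a multiple of the pivot row, so a
    relation between the rows gives one between the eliminated rows. Induction kills its
    coefficients, and the first column then kills [c 0]. Integer pivots stay nonzero in F, so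
    elimination over [int] suffices. *)
Lemma eliminable_indep (F : numFieldType) n (rows : seq (seq int))
    (c : nat -> F) :
  size rows = n -> all (fun r => size r == n) rows -> eliminable n rows ->
  (forall j, (j < n)%N -> \sum_(i < n) c i * ((nth [::] rows i)`_j)%:~R = 0) ->
  forall i, (i < n)%N -> c i = 0.
Proof.
elim: n rows c => // n IH [|[|a r] rows] // c [szr] /andP[/eqP[sr] /allP sz].
move=> /andP[a0 el] cE.
(* [g i] is the factor by which [elim_row] rescales row [i.+1]. *)
pose g i : F := if (nth [::] rows i)`_0 == 0 then 1 else a%:~R.
have a0F : a%:~R != 0 :> F by rewrite intr_eq0.
have g0 i : g i != 0 by rewrite /g; case: ifP; rewrite ?oner_eq0.
have szi i : (i < n)%N -> size (nth [::] rows i) = n.+1.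
  by move=> ilt; apply/eqP/sz/mem_nth; rewrite szr.
have c00 : c 0%N * a%:~R + \sum_(i < n) c i.+1 * ((nth [::] rows i)`_0)%:~R = 0.
  by have := cE 0%N isT; rewrite big_ord_recl.
have cS i : (i < n)%N -> c i.+1 = 0.
  move=> ilt; suff : c i.+1 / g i = 0.
    by move/eqP; rewrite mulf_eq0 invr_eq0 (negPf (g0 i)) orbF => /eqP.
  apply: (IH [seq elim_row a r s | s <- rows] (fun i => c i.+1 / g i)) => //.
  - by rewrite size_map.
  - rewrite all_map; apply/allP => s /sz /eqP; case: s => //= b s [ss].
    by case: ifP => _; rewrite ?ss // size_map size_zip ss sr minnn.
  move=> j jlt; transitivity (\sum_(i < n)
    (c i.+1 * ((nth [::] rows i)`_j.+1)%:~R
     - (r`_j)%:~R / a%:~R * (c i.+1 * ((nth [::] rows i)`_0)%:~R)) : F).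
    apply: eq_bigr => -[k klt] _ /=; have := szi k klt.
    rewrite (nth_map [::]) ?szr // /g; case: (nth [::] rows k) => //= b s [ss].
    case: eqP => [->|_]; first by rewrite mulr0z !mulr0 subr0 divr1.
    rewrite (nth_map (0, 0)) ?size_zip ?ss ?sr ?minnn // nth_zip ?ss //=.
    by rewrite rmorphB !rmorphM /=; field.
  (* Column j + 1 evaluates the first sum to - c_0 r_j and column 0 evaluates the second to - c_0 a;
     the two contributions cancel. *)
  rewrite sumrB -mulr_sumr.
  have := cE j.+1 jlt; rewrite big_ord_recl /= addrC => /eqP.
  rewrite addr_eq0 => /eqP ->.
  have := c00; rewrite addrC => /eqP; rewrite addr_eq0 => /eqP ->.
  by field.
case=> [_|i]; last exact: cS.
move: c00; rewrite big1 ?addr0 => [/eqP|i _]; last by rewrite cS ?mul0r.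
by rewrite mulf_eq0 (negPf a0F) orbF => /eqP.
Qed.

(** * Koszul flattenings and border rank *)

Lemma cvg_sumC (R : realType) (I : finType) (u : I -> nat -> R[i])
    (a : I -> R[i]) :
  (forall i, (fun k => u i k : R[i]^o) @ \oo --> (a i : R[i]^o)) ->
  (fun k => \sum_i u i k : R[i]^o) @ \oo --> (\sum_i a i : R[i]^o).
Proof.
by move=> h; apply: (@cvg_big _ _ +%R) => //=; exact: add_continuous.
Qed.

Lemma cvg_prodC (R : realType) (I : finType) (u : I -> nat -> R[i])
    (a : I -> R[i]) :
  (forall i, (fun k => u i k : R[i]^o) @ \oo --> (a i : R[i]^o)) ->
  (fun k => \prod_i u i k : R[i]^o) @ \oo --> (\prod_i a i : R[i]^o).
Proof.
by move=> h; apply: (cvg_big (@mul_continuous R[i])) => i _; exact: h.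
Qed.

Lemma cvg_det (R : realType) n (A : nat -> 'M[R[i]]_n) (B : 'M[R[i]]_n) :
  (forall i j, (fun k => A k i j : R[i]^o) @ \oo --> (B i j : R[i]^o)) ->
  (fun k => \det (A k) : R[i]^o) @ \oo --> (\det B : R[i]^o).
Proof.
move=> h; apply: cvg_sumC => s; apply: cvgM; first exact: cvg_cst.
exact: cvg_prodC.
Qed.

(** If C is a right inverse of B, then det (A k C) tends to det (B C) = 1, whereas d < n would force
    all these determinants to be 0. *)
Lemma row_free_limit (R : realType) n p d (A : nat -> 'M[R[i]]_(n, p))
    (B : 'M[R[i]]_(n, p)) :
  (forall i j, (fun k => A k i j : R[i]^o) @ \oo --> (B i j : R[i]^o)) ->
  (forall k, \rank (A k) <= d)%N -> row_free B -> (n <= d)%N.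
Proof.
move=> h rk /row_freeP[C BC]; rewrite leqNgt; apply/negP => dn.
have : (fun k => \det (A k *m C) : R[i]^o) @ \oo --> (\det (B *m C) : R[i]^o).
  apply: cvg_det => i j; rewrite mxE; under eq_fun do rewrite mxE.
  apply: cvg_sumC => s; apply: cvgM; [exact: h | exact: cvg_cst].
have det0 k : \det (A k *m C) = 0.
  apply/eqP; rewrite -[_ == 0]negbK -unitfE -[_ \is a _]/(_ \in unitmx).
  rewrite -row_full_unit; apply: contraL dn => /eqP <-; rewrite -leqNgt.
  by rewrite (leq_trans (mxrankM_maxl _ _)).
under eq_fun do rewrite det0.
rewrite BC det1 => /(cvg_unique (@norm_hausdorff _ R[i]^o) (cvg_cst _)) /eqP.
by rewrite eq_sym oner_eq0.
Qed.

(* Send a_i to the vector f i of C^5. This is the matrix entry, in row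
   (e_m /\ e_n) (x) b_j and column (e_u /\ e_v /\ e_w) (x) c_k, of the induced
   Koszul flattening Lambda^2 C^5 (x) B^* -> Lambda^3 C^5 (x) C of T. *)
Definition koszul (F : fieldType) (I J K : finType) (f : I -> nat -> F)
    (T : {ffun I * J * K -> F}) (x : 'I_5 * 'I_5 * J)
    (y : 'I_5 * 'I_5 * 'I_5 * K) : F :=
  det3 (fun l => \sum_i T (i, x.2, y.2) * f i l)
    (unit_vect F x.1.1) (unit_vect F x.1.2) y.1.1.1 y.1.1.2 y.1.2.

Definition koszul_mx (F : fieldType) (I J K : finType) (f : I -> nat -> F)
    (n : nat) (r : 'I_n -> 'I_5 * 'I_5 * J) (T : {ffun I * J * K -> F}) :=
  \matrix_(i < n, j < #|{: 'I_5 * 'I_5 * 'I_5 * K}|)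
    koszul f T (r i) (enum_val j).

Lemma koszulE (F : fieldType) (I J K : finType) (f : I -> nat -> F)
    (T : {ffun I * J * K -> F}) x y :
  koszul f T x y = \sum_i T (i, x.2, y.2) *
    det3 (f i) (unit_vect F x.1.1) (unit_vect F x.1.2) y.1.1.1 y.1.1.2 y.1.2.
Proof. exact: det3_suml. Qed.

(** Up to the factors b_j c_k, the flattening is the wedge with the image of a, and [wedge_factor]
    factors it through a space of dimension 6. *)
Lemma rank_koszul_rank_one (R : realType) (I J K : finType)
    (f : I -> nat -> R[i]) (n : nat) (r : 'I_n -> 'I_5 * 'I_5 * J)
    (T : tensor R I J K) :
  rank_one T -> (\rank (koszul_mx f r T) <= 6)%N.
Proof.
move=> [a [b [c ->]]].
have [G [H GH]] := wedge_factor (fun l => \sum_i a i * f i l).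
pose M := \matrix_(i < n, s < 6) (b (r i).2 * G (r i).1.1 (r i).1.2 s).
pose N := \matrix_(s < 6, j < #|{: 'I_5 * 'I_5 * 'I_5 * K}|)
  (let y := enum_val j in H s y.1.1.1 y.1.1.2 y.1.2 * c y.2).
suff -> : koszul_mx f r (tprod a b c) = M *m N by exact: mulmx_max_rank.
apply/matrixP => i j; rewrite !mxE; case ri: (r i) => [[m m'] j'].
case yj: (enum_val j) => [[[u v] w] k]; rewrite koszulE /=.
transitivity (b j' * c k * det3 (fun l => \sum_i a i * f i l)
   (unit_vect R[i] m) (unit_vect R[i] m') u v w).
  rewrite det3_suml mulr_sumr; apply: eq_bigr => s _.
  by rewrite ffunE /=; ring.
rewrite GH // mulr_sumr; apply: eq_bigr => s _.
by rewrite !mxE ri yj /=; ring.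
Qed.

Lemma rank_koszul_sum (R : realType) (I J K : finType) (f : I -> nat -> R[i])
    (n d : nat) (r : 'I_n -> 'I_5 * 'I_5 * J) (T : tensor R I J K) :
  sum_rank_one d T -> (\rank (koszul_mx f r T) <= 6 * d)%N.
Proof.
move=> [t t1 ->].
have -> : koszul_mx f r (\sum_(s < d) t s) = \sum_(s < d) koszul_mx f r (t s).
  apply/matrixP => i j; rewrite summxE mxE koszulE.
  under [RHS]eq_bigr do rewrite mxE koszulE.
  rewrite exchange_big; apply: eq_bigr => k _.
  by rewrite sum_ffunE mulr_suml.
rewrite mulnC -[X in (X * 6)%N](card_ord d) -sum_nat_const.
elim/big_ind2: _ => [|m A' m' B' hA hB|s _]; first by rewrite mxrank0.
  by rewrite (leq_trans (mxrank_add _ _)) // leq_add.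
exact: rank_koszul_rank_one.
Qed.

(** The flattening is linear, hence continuous, in T, so independent rows at the limit contradict a
    rank below #|N| along the sequence. The rows are indexed by any finite type, to allow a disjoint
    union of blocks. *)
Lemma koszul_bound (R : realType) (I J K N : finType) (f : I -> nat -> R[i])
    (d : nat) (r : N -> 'I_5 * 'I_5 * J) (T : tensor R I J K) :
  (forall c : N -> R[i], (forall y, \sum_s c s * koszul f T (r s) y = 0) ->
    forall s, c s = 0) ->
  limit_sum_rank_one d T -> (#|N| <= 6 * d)%N.
Proof.
move=> indep [u ud uT].
apply: (@row_free_limit R _ _ _ (fun k => koszul_mx f (r \o enum_val) (u k))
  (koszul_mx f (r \o enum_val) T)).
- move=> i j; rewrite mxE koszulE; under eq_fun do rewrite mxE koszulE.
  by apply: cvg_sumC => s; apply: cvgM; [exact: uT | exact: cvg_cst].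
- by move=> k; exact: rank_koszul_sum.
rewrite -kermx_eq0; apply/rowV0P => v /sub_kermxP vK.
apply/rowP => i; rewrite mxE -(enum_valK i).
apply: (indep (fun s => v 0 (enum_rank s))) => y.
move/rowP/(_ (enum_rank y)): vK; rewrite !mxE => vy; rewrite -[RHS]vy.
rewrite (reindex (@enum_val N predT)) /=; last exact/onW_bij/enum_val_bij.
by apply: eq_bigr => s _; rewrite !mxE enum_valK enum_rankK.
Qed.

(** * The flattening of the square of T_cw *)

(** The matrix obtained from T_cw by applying the linear form a_i |-> g i to the first factor; its
    formula does not involve q. *)
Definition slice (F : pzRingType) (g : nat -> F) (j k : nat) : F :=
  if j == 0%N then if k == 0%N then 0 else g k
  else if k == 0%N then g j else if j == k then g 0%N else 0.

Lemma eq_slice (F : pzRingType) (g h : nat -> F) : g =1 h -> slice g =2 slice h.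
Proof. by move=> gh j k; rewrite /slice !gh. Qed.

Lemma slice0 (F : pzRingType) j k : slice (fun=> 0 : F) j k = 0.
Proof. by rewrite /slice; do !case: ifP => //. Qed.

Lemma slice_intr (F : pzRingType) (g : nat -> int) (j k : nat) :
  slice (fun i => (g i)%:~R : F) j k = (slice g j k)%:~R.
Proof. by rewrite /slice; do !case: ifP => //. Qed.

Lemma sum_delta (F : comPzRingType) (I : finType) (i0 : I) (g : I -> F)
    (c : F) :
  \sum_i (i == i0)%:R * c * g i = c * g i0.
Proof.
rewrite (bigD1 i0) //= eqxx mul1r big1 ?addr0 // => i /negPf ->.
by rewrite !mul0r.
Qed.

Lemma sum_Tcw (R : realType) q (g : nat -> R[i]) (j k : 'I_q.+1) :
  \sum_i Tcw R q (i, j, k) * g i = slice g j k.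
Proof.
transitivity (\sum_(s < q)
   ((j == lift ord0 s)%:R * (k == lift ord0 s)%:R * g 0%N
    + (j == ord0)%:R * (k == lift ord0 s)%:R * g s.+1
    + (j == lift ord0 s)%:R * (k == ord0)%:R * g s.+1)).
  under eq_bigr do rewrite sum_ffunE mulr_suml.
  rewrite exchange_big; apply: eq_bigr => s _ /=.
  have sum0 c : \sum_(i < q.+1) (i == ord0)%:R * c * g i = c * g 0%N.
    exact: (sum_delta ord0 (fun i => g i)).
  have sumS c : \sum_(i < q.+1) (i == lift ord0 s)%:R * c * g i = c * g s.+1.
    exact: (sum_delta (lift ord0 s) (fun i => g i)).
  rewrite -sum0 -!sumS -!big_split /=.
  by apply: eq_bigr => i _; rewrite !ffunE /=; ring.
have sumE (a : 'I_q) (h : 'I_q -> R[i]) :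
    \sum_(s < q) (lift ord0 a == lift ord0 s)%:R * h s = h a.
  rewrite (bigD1 a) //= eqxx mul1r big1 ?addr0 // => s /negPf sa.
  by rewrite (inj_eq lift_inj) eq_sym sa mul0r.
under eq_bigr do rewrite -!mulrA.
rewrite /slice !big_split /=.
case: (unliftP ord0 j) => [a|] ->; case: (unliftP ord0 k) => [a'|] ->.
- rewrite !sumE [X in _ + X + _]big1 => [|s _]; last by rewrite mul0r.
  rewrite (inj_eq lift_inj) mul0r !addr0 /= (can_eq (@bumpK 0)) eq_sym.
  by rewrite -[val a == _]/(a == a'); case: eqP; rewrite ?mul1r ?mul0r.
- rewrite !sumE [X in _ + X + _]big1 => [|s _]; last by rewrite mul0r.
  by rewrite mul0r !add0r !eqxx mul1r.
- rewrite [X in X + _ + _]big1 => [|s _]; last by rewrite mul0r.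
  rewrite [X in _ + X]big1 => [|s _]; last by rewrite mul0r.
  by rewrite add0r addr0; under eq_bigr do rewrite eqxx mul1r; rewrite sumE.
- by rewrite !big1 ?addr0 // => s _; rewrite ?mul0r ?mulr0.
Qed.

Lemma sum_kron_Tcw (R : realType) q (f : nat -> nat -> int)
    (x y : 'I_q.+1 * 'I_q.+1) :
  \sum_i kron (Tcw R q) (Tcw R q) (i, x, y) * (f i.1 i.2)%:~R
  = (slice (fun i => slice (f i) x.2 y.2) x.1 y.1)%:~R.
Proof.
transitivity (\sum_(i < q.+1) \sum_(i' < q.+1)
    kron (Tcw R q) (Tcw R q) ((i, i'), x, y) * (f i i')%:~R).
  by rewrite pair_bigA; apply: eq_bigr => -[].
rewrite -slice_intr -sum_Tcw; apply: eq_bigr => i _.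
rewrite -slice_intr -sum_Tcw mulr_sumr.
by apply: eq_bigr => i' _; rewrite ffunE mulrA.
Qed.

(* A contraction supported on 0, ..., b does not mix a coordinate b + 1 + s with
   any other one, which is what block-diagonalizes the flattening; j is ignored
   when t = Some s. *)
Definition coord (b d : nat) (t : option 'I_d) (j : nat) : nat :=
  if t is Some s then (b.+1 + s)%N else j.

(** An index beyond b pairs only with itself, through the term a_0 (x) b_j (x) c_j, hence the entry
    [g 0]. *)
Definition reduced_slice (big : bool) (g : nat -> int) (j k : nat) : int :=
  if big then g 0%N else slice g j k.

Lemma slice_coord b d (g : nat -> int) (t t' : option 'I_d) j k :
  (forall i, (b < i)%N -> g i = 0) -> (j <= b)%N -> (k <= b)%N ->
  slice g (coord b t j) (coord b t' k)
  = if t == t' then reduced_slice (isSome t) g j k else 0.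
Proof.
move=> gb jb kb; case: t t' => [s|] [s'|] //=; rewrite /slice /=.
- by rewrite eqn_add2l.
- by case: eqP => _; [rewrite gb ?leq_addr|case: eqP => //; lia].
- by case: eqP => _; [rewrite gb ?leq_addr|case: eqP => //; lia].
Qed.

(* ((m, n, j, j'), (u, v, w, k, k')) stands for the row
   (e_m /\ e_n) (x) (b_j (x) b_j') and the column
   (e_u /\ e_v /\ e_w) (x) (c_k (x) c_k') of a flattening. *)
Definition pivot :=
  (nat * nat * nat * nat * (nat * nat * nat * nat * nat))%type.

Definition pivot_le (b : nat) (p : pivot) : bool :=
  let '((m, n, j, j'), (u, v, w, k, k')) := p in
  all (leq^~ 4%N) [:: m; n; u; v; w] && all (leq^~ b) [:: j; j'; k; k'].

(** A list of pivots selects a square submatrix: the rows come from the first components, the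
    columns from the second ones. *)
Definition pivot_entry (X : nat -> nat -> nat -> nat -> nat -> int)
    (p q : pivot) : int :=
  let '((m, n, j, j'), _) := p in let '(_, (u, v, w, k, k')) := q in
  det3 (X j j' k k') (unit_vect int m) (unit_vect int n) u v w.

Definition independent_pivots (X : nat -> nat -> nat -> nat -> nat -> int)
    (ps : seq pivot) : bool :=
  eliminable (size ps) [seq [seq pivot_entry X p q | q <- ps] | p <- ps].

(** Coordinate l of the vector of C^5 at given b and c indices. Neither d nor the actual values of
    the indices beyond b occur, so one certificate serves all blocks of a kind. *)
Definition block (f : nat -> nat -> nat -> int) (big big' : bool)
    (j j' k k' l : nat) : int :=
  reduced_slice big (fun i => reduced_slice big' (f i ^~ l) j' k') j k.

Definition pivot_row (b d : nat) (t t' : option 'I_d) (p : pivot) :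
    'I_5 * 'I_5 * ('I_(b + d).+1 * 'I_(b + d).+1) :=
  let '((m, n, j, j'), _) := p in
  (inord m, inord n, (inord (coord b t j), inord (coord b t' j'))).

Definition pivot_col (b d : nat) (t t' : option 'I_d) (p : pivot) :
    'I_5 * 'I_5 * 'I_5 * ('I_(b + d).+1 * 'I_(b + d).+1) :=
  let '(_, (u, v, w, k, k')) := p in
  (inord u, inord v, inord w, (inord (coord b t k), inord (coord b t' k'))).

(** As f vanishes when either index exceeds b, [slice_coord] applies to the two Kronecker factors in
    turn, which gives block diagonality. *)
Lemma koszul_pivot (R : realType) (b d : nat) (f : nat -> nat -> nat -> int)
    (t t' s s' : option 'I_d) (p q : pivot) :
  (forall i i' l, (b < i)%N || (b < i')%N -> f i i' l = 0) ->
  pivot_le b p -> pivot_le b q ->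
  koszul (fun (i : 'I_(b + d).+1 * 'I_(b + d).+1) l => (f i.1 i.2 l)%:~R)
    (kron (Tcw R (b + d)) (Tcw R (b + d)))
    (pivot_row b t t' p) (pivot_col b s s' q)
  = if (t, t') == (s, s')
    then (pivot_entry (block f (isSome t) (isSome t')) p q)%:~R else 0.
Proof.
move=> fb; case: p => [[[[m n] j] j'] [[[[? ?] ?] ?] ?]].
case: q => [[[[? ?] ?] ?] [[[[u v] w] k] k']].
move=> /andP[/and5P[mb nb _ _ _] /and4P[jb jb' _ _]].
case/andP=> [/and5P[_ _ ub vb /andP[wb _]] /and4P[_ _ kb /andP[kb' _]]].
have cb (r : option 'I_d) i : (i <= b)%N -> (coord b r i < (b + d).+1)%N.
  by case: r => [[r rd]|] /=; lia.
rewrite /koszul /pivot_row /pivot_col /pivot_entry /=.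
rewrite !inordK // xpair_eqE.
have E l : \sum_i kron (Tcw R (b + d)) (Tcw R (b + d))
      (i, (inord (coord b t j), inord (coord b t' j')),
          (inord (coord b s k), inord (coord b s' k'))) * (f i.1 i.2 l)%:~R
    = ((if (t == s) && (t' == s') then
         block f (isSome t) (isSome t') j j' k k' l else 0)%:~R : R[i]).
  rewrite (sum_kron_Tcw _ (fun i i' => f i i' l)) /= !inordK ?cb //.
  congr (_%:~R).
  have inner i := slice_coord t' s'
    (fun i' ib => fb i i' l (introT orP (or_intror ib))) jb' kb'.
  rewrite (eq_slice inner).
  case: (t' == s'); last by rewrite slice0 andbF.
  rewrite andbT slice_coord // => i ib.
  have f0 i' : f i i' l = 0 by rewrite fb ?ib.
  rewrite /reduced_slice; case: isSome => //.
  by rewrite (eq_slice f0) slice0.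
rewrite (eq_det3 _ _ _ _ _ E).
case: ifP => _; last by rewrite /det3; ring.
rewrite det3_intr; congr det3; apply/funext => i; rewrite /unit_vect.
  by case: eqP.
by case: eqP.
Qed.

Lemma big_option (T : Type) (idx : T) (op : Monoid.com_law idx) (S : finType)
    (G : option S -> T) :
  \big[op/idx]_o G o = op (G None) (\big[op/idx]_s G (Some s)).
Proof.
rewrite (bigD1 None) //=; congr (op _ _).
rewrite (reindex_omap Some id) => [|[]] //=.
by apply: eq_bigl => s; rewrite eqxx.
Qed.

Lemma sum_option (d : nat) (F : bool -> nat) :
  (\sum_(t : option 'I_d) F (isSome t) = F false + d * F true)%N.
Proof. by rewrite big_option /= sum_nat_const card_ord. Qed.

(** There are 1, d, d and d^2 blocks of the four kinds, and [N] below is the disjoint union of their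
    pivots. A relation between the rows, read at the pivot columns of one block, involves only the
    rows of that block, where the certificate applies. *)
Lemma koszul_lower_bound (R : realType) (b d r : nat)
    (f : nat -> nat -> nat -> int) (ps : bool -> bool -> seq pivot) :
  (forall i i' l, (b < i)%N || (b < i')%N -> f i i' l = 0) ->
  (forall t t', all (pivot_le b) (ps t t')) ->
  (forall t t', independent_pivots (block f t t') (ps t t')) ->
  limit_sum_rank_one r (kron (Tcw R (b + d)) (Tcw R (b + d))) ->
  (size (ps false false) + d * size (ps false true)
   + d * (size (ps true false) + d * size (ps true true)) <= 6 * r)%N.
Proof.
move=> fb psb psi Tr.
pose sz (t : option 'I_d * option 'I_d) := size (ps (isSome t.1) (isSome t.2)).
pose N := {t : option 'I_d * option 'I_d & 'I_(sz t)}.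
pose p0 : pivot := (0, 0, 0, 0, (0, 0, 0, 0, 0))%N.
pose p (s : N) := nth p0 (ps (isSome (tag s).1) (isSome (tag s).2)) (tagged s).
have pb s : pivot_le b (p s) by apply: (allP (psb _ _)); exact: mem_nth.
have -> : (size (ps false false) + d * size (ps false true)
   + d * (size (ps true false) + d * size (ps true true)) = #|{: N}|)%N.
  rewrite card_tagged sumnE big_map big_enum /=.
  under eq_bigr do rewrite card_ord.
  rewrite -(pair_bigA _ (fun t t' => size (ps (isSome t) (isSome t')))) /=.
  under eq_bigr => t do
    rewrite (sum_option _ (fun t' => size (ps (isSome t) t'))).
  by rewrite (sum_option _
    (fun t => size (ps t false) + d * size (ps t true)))%N.
apply: (koszul_bound
  (f := fun (i : 'I_(b + d).+1 * 'I_(b + d).+1) l => (f i.1 i.2 l)%:~R)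
  (r := fun s : N => pivot_row b (tag s).1 (tag s).2 (p s))) Tr.
have sigE (G : N -> R[i]) :
    \sum_s G s = \sum_t \sum_(i < sz t) G (existT (fun t => 'I_(sz t)) t i).
  rewrite (sig_big_dep xpredT (fun _ _ => true)
    (fun t i => G (existT (fun t => 'I_(sz t)) t i))) /=.
  by apply: eq_bigr => -[].
move=> c cE [t0 i0].
pose ps0 := ps (isSome t0.1) (isSome t0.2).
pose X := block f (isSome t0.1) (isSome t0.2).
(* [insubd i0] turns a natural number into an index of the block; the default [i0] is never reached
   below [size ps0]. *)
have := @eliminable_indep R[i] (size ps0)
  [seq [seq pivot_entry X p q | q <- ps0] | p <- ps0]
  (fun k => c (existT (fun t => 'I_(sz t)) t0 (insubd i0 k)))
  (size_map _ _) _ (psi _ _) _ i0 (ltn_ord i0).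
rewrite valKd; apply.
  by rewrite all_map; apply/allP => q _ /=; rewrite size_map.
move=> k kn.
pose q : N := existT (fun t => 'I_(sz t)) t0 (Ordinal (kn : (k < sz t0)%N)).
have := cE (pivot_col b t0.1 t0.2 (p q)).
rewrite (eq_bigr (fun s : N => c s *
    (if tag s == t0 then (pivot_entry X (p s) (p q))%:~R else 0))); last first.
  move=> s _; rewrite koszul_pivot //; congr (_ * _).
  rewrite -!surjective_pairing; case: eqP => // e; congr (_%:~R).
  by rewrite /X -e.
rewrite sigE /=.
rewrite (bigD1 t0) //= [X in _ + X]big1 => [|t /negPf tt0]; last first.
  by rewrite big1 // => i _; rewrite tt0 mulr0.
rewrite addr0 eqxx => e; rewrite -[RHS]e; apply: eq_bigr => i _; rewrite valKd.
by rewrite (nth_map p0) // (nth_map p0).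
Qed.

(** * Certificates *)

(* The entry (l, a) of the table at position (i, i') means that a_i (x) a_i' is
   sent to a e_l in C^5. *)
Definition projection (table : seq (seq (nat * int))) (i i' l : nat) : int :=
  let: (m, a) := nth (0%N, 0) (nth [::] table i) i' in if l == m then a else 0.

Lemma projection_out (table : seq (seq (nat * int))) (b i i' l : nat) :
  (size table <= b.+1)%N -> all (fun r => size r <= b.+1)%N table ->
  (b < i)%N || (b < i')%N -> projection table i i' l = 0.
Proof.
move=> tb rb ii'; rewrite /projection.
suff -> : nth (0%N, 0) (nth [::] table i) i' = (0%N, 0) by case: ifP.
apply: nth_default; case/orP: ii' => bi.
  by rewrite (nth_default _ (leq_trans tb bi)).
by case: (ltnP i (size table)) => it; [
  exact: leq_trans (allP rb _ (mem_nth _ it)) bi | rewrite nth_default].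
Qed.

(* The tables and the pivots below come from a computer search: sparse integer
   projections whose flattenings have large enough rank, with pivots ordered so
   that the entries met during the elimination stay at most 4 in absolute
   value. *)
Definition table3 : seq (seq (nat * int)) :=
  [:: [:: (0, 1%R); (2, 1%R); (4, 1%R); (1, 1%R)];
      [:: (3, 1%R)];
      [:: (1, 1%R); (0, 0%R); (2, 1%R); (1, 1%R)];
      [:: (4, 1%R); (0, 0%R); (3, -1%R)]]%N.

Definition table2 : seq (seq (nat * int)) :=
  [:: [:: (0, 1%R); (4, 1%R); (3, 1%R)];
      [:: (4, 1%R); (2, 1%R); (0, -1%R)];
      [:: (3, 1%R); (0, -1%R); (1, 1%R)]]%N.

Definition pivots3 : seq pivot :=
  [:: ((1,4,1,1),(0,1,4,1,1)); ((2,3,1,1),(0,2,3,1,1));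
      ((1,2,1,2),(0,1,2,1,2)); ((3,4,1,2),(0,3,4,1,2));
      ((1,3,1,3),(0,1,3,1,3)); ((2,4,1,3),(0,2,4,1,3));
      ((1,2,2,1),(0,1,2,2,1)); ((3,4,2,1),(0,3,4,2,1));
      ((1,2,2,3),(0,1,2,2,3)); ((1,3,2,3),(0,1,3,2,3));
      ((1,4,2,3),(0,1,4,2,3)); ((2,3,2,3),(0,2,3,2,3));
      ((2,4,2,3),(0,2,4,2,3)); ((1,4,2,2),(1,2,4,0,0));
      ((3,4,2,3),(0,3,4,2,3)); ((1,3,3,1),(0,1,3,3,1));
      ((2,4,3,1),(0,2,4,3,1)); ((1,2,3,2),(0,1,2,3,2));
      ((1,3,2,2),(1,2,3,0,0)); ((1,4,3,2),(1,3,4,0,0));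
      ((3,4,3,2),(0,3,4,3,2)); ((1,4,3,3),(0,1,4,3,3));
      ((2,3,3,3),(0,2,3,3,3)); ((3,4,0,1),(1,3,4,2,1));
      ((0,3,0,2),(0,1,3,2,2)); ((2,3,0,3),(2,3,4,3,3));
      ((2,4,0,3),(2,3,4,1,3)); ((3,4,0,3),(1,3,4,2,0));
      ((0,2,2,1),(0,1,2,0,1)); ((0,3,2,1),(0,2,3,2,0));
      ((0,3,2,2),(0,3,4,2,0)); ((0,4,2,2),(0,2,4,0,0));
      ((0,4,2,3),(0,1,4,0,0)); ((1,2,1,0),(1,2,4,1,2));
      ((0,3,1,2),(0,3,4,1,0)); ((1,2,2,0),(1,2,4,2,2));
      ((1,3,3,0),(1,2,3,3,1)); ((2,3,3,0),(1,2,3,3,3));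
      ((0,1,3,2),(0,1,4,0,2)); ((0,3,2,3),(0,1,3,0,0));
      ((0,3,0,3),(0,1,3,2,0)); ((3,4,3,3),(0,3,4,3,3));
      ((0,2,3,2),(0,2,3,0,0)); ((2,4,1,0),(1,2,4,1,3));
      ((0,2,1,3),(0,2,3,0,3)); ((0,3,1,3),(0,1,3,1,0));
      ((0,4,2,0),(0,2,4,0,2)); ((2,4,2,1),(0,2,4,2,1));
      ((1,2,3,1),(1,2,4,0,1)); ((0,1,3,0),(0,1,2,3,1));
      ((0,1,1,2),(0,1,3,0,2)); ((0,4,1,3),(0,1,4,1,0));
      ((3,4,2,0),(2,3,4,2,1)); ((0,4,3,0),(0,3,4,0,2));
      ((0,3,3,2),(0,3,4,3,0)); ((0,2,3,3),(0,2,4,0,3));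
      ((0,3,3,3),(0,3,4,0,3)); ((0,4,3,3),(0,1,4,3,0));
      ((1,4,0,1),(1,3,4,1,1)); ((0,1,0,2),(0,1,3,3,0));
      ((1,3,1,2),(0,1,3,1,2)); ((3,4,1,3),(1,3,4,1,0));
      ((0,4,0,3),(0,3,4,1,3)); ((0,1,2,2),(0,1,4,2,0));
      ((0,2,2,3),(0,1,2,0,0)); ((0,2,2,0),(0,1,2,0,3));
      ((1,2,0,2),(1,2,3,1,2)); ((1,2,3,0),(1,2,4,3,2));
      ((1,4,0,3),(1,3,4,1,3)); ((3,4,1,0),(2,3,4,1,1));
      ((2,4,0,1),(1,2,4,2,1)); ((0,1,1,1),(0,1,3,0,1));
      ((0,2,1,1),(0,2,3,0,1)); ((0,1,1,3),(0,1,3,0,3));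
      ((0,2,0,0),(0,2,3,3,2)); ((0,4,0,0),(0,2,4,2,2));
      ((2,4,2,2),(1,2,4,0,2)); ((1,2,0,0),(1,2,3,3,2));
      ((1,4,0,0),(1,3,4,3,2)); ((0,4,3,2),(0,3,4,0,0));
      ((1,4,1,0),(1,2,4,1,1)); ((0,3,1,1),(0,2,3,1,0));
      ((0,1,2,1),(0,1,2,2,0)); ((0,1,3,1),(0,1,2,3,0));
      ((0,4,2,1),(0,1,4,0,1)); ((0,4,3,1),(0,2,4,3,0));
      ((0,3,0,0),(0,2,3,2,2)); ((1,3,0,0),(1,2,3,2,2));
      ((2,3,0,2),(2,3,4,3,2)); ((2,4,0,0),(1,2,4,2,3));
      ((2,4,2,0),(1,2,4,0,3)); ((1,2,3,3),(0,1,2,3,3));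
      ((3,4,0,0),(1,3,4,2,3)); ((2,3,2,0),(2,3,4,2,2));
      ((1,2,1,3),(1,2,3,0,3)); ((0,2,1,0),(0,1,2,1,3));
      ((2,4,1,2),(0,2,4,1,2)); ((1,3,0,2),(1,2,3,2,0));
      ((1,3,2,1),(0,1,3,2,1)); ((0,3,0,1),(0,3,4,3,1));
      ((3,4,3,1),(2,3,4,3,0)); ((2,3,3,2),(2,3,4,0,2));
      ((2,4,0,2),(2,3,4,1,2)); ((2,3,1,0),(1,2,3,1,3));
      ((2,4,3,0),(1,2,4,3,3)); ((1,3,0,1),(1,3,4,3,1));
      ((1,3,0,3),(1,3,4,3,3)); ((3,4,3,0),(2,3,4,3,1));
      ((2,3,0,1),(1,2,3,2,1)); ((0,2,3,1),(0,2,4,0,1));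
      ((0,1,3,3),(0,1,4,0,3)); ((2,3,0,0),(1,2,3,2,3));
      ((1,2,1,1),(0,1,2,1,1)); ((1,3,1,1),(0,1,3,1,1));
      ((2,4,1,1),(0,2,4,1,1)); ((3,4,1,1),(0,3,4,1,1));
      ((1,4,1,2),(0,1,4,1,2)); ((2,3,1,2),(0,2,3,1,2));
      ((1,4,1,3),(0,1,4,1,3)); ((2,3,1,3),(0,2,3,1,3));
      ((1,4,2,1),(0,1,4,2,1)); ((2,3,2,1),(0,2,3,2,1));
      ((2,3,2,2),(1,2,3,0,2)); ((1,4,3,1),(0,1,4,3,1));
      ((2,3,3,1),(0,2,3,3,1)); ((2,4,3,2),(2,3,4,0,0));
      ((1,3,3,3),(0,1,3,3,3)); ((2,4,3,3),(0,2,4,3,3));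
      ((0,4,0,1),(2,3,4,1,0)); ((0,4,0,2),(0,1,4,2,2));
      ((3,4,0,2),(1,3,4,2,2)); ((0,2,0,3),(1,2,3,1,0));
      ((0,2,2,2),(0,1,2,0,2)); ((0,1,1,0),(1,2,3,0,1));
      ((1,3,1,0),(1,3,4,1,2)); ((0,2,1,2),(0,2,4,1,0));
      ((0,3,3,0),(2,3,4,0,1)); ((1,2,0,1),(1,2,3,1,1));
      ((0,4,1,1),(0,3,4,0,1)); ((0,1,0,0),(0,1,3,3,2));
      ((1,4,3,0),(1,2,4,3,1)); ((0,3,3,1),(0,2,3,3,0));
      ((1,2,2,2),(0,1,2,2,2)); ((3,4,2,2),(0,3,4,2,2));
      ((1,3,3,2),(1,3,4,3,0))]%N.

(** Here the first coordinate exceeds 3, so j and k are ignored and written 0; in [pivots3l] this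
    holds for j' and k'. *)
Definition pivots3r : seq pivot :=
  [:: ((1,2,0,1),(0,1,2,0,1)); ((1,3,0,1),(0,1,3,0,1));
      ((1,4,0,1),(0,1,4,0,1)); ((2,3,0,1),(0,2,3,0,1));
      ((2,4,0,1),(0,2,4,0,1)); ((3,4,0,1),(0,3,4,0,1));
      ((1,2,0,2),(0,1,2,0,2)); ((1,3,0,2),(0,1,3,0,2));
      ((1,4,0,2),(0,1,4,0,2)); ((2,3,0,2),(0,2,3,0,2));
      ((2,4,0,2),(0,2,4,0,2)); ((3,4,0,2),(0,3,4,0,2));
      ((1,2,0,3),(0,1,2,0,3)); ((1,3,0,3),(0,1,3,0,3));
      ((1,4,0,3),(0,1,4,0,3)); ((2,3,0,3),(0,2,3,0,3));
      ((2,4,0,3),(0,2,4,0,3)); ((3,4,0,3),(0,3,4,0,3));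
      ((1,2,0,0),(1,2,4,0,2)); ((1,3,0,0),(1,3,4,0,2));
      ((2,3,0,0),(2,3,4,0,2)); ((0,1,0,2),(0,1,4,0,0));
      ((0,2,0,2),(0,2,4,0,0)); ((0,3,0,2),(0,3,4,0,0));
      ((2,4,0,0),(1,2,4,0,3)); ((3,4,0,0),(1,3,4,0,3));
      ((0,2,0,3),(0,1,2,0,0)); ((0,3,0,3),(0,1,3,0,0));
      ((1,4,0,0),(1,2,4,0,1)); ((0,3,0,1),(0,2,3,0,0))]%N.

Definition pivots3l : seq pivot :=
  [:: ((1,2,1,0),(0,1,2,1,0)); ((1,3,1,0),(0,1,3,1,0));
      ((1,4,1,0),(0,1,4,1,0)); ((2,3,1,0),(0,2,3,1,0));
      ((2,4,1,0),(0,2,4,1,0)); ((3,4,1,0),(0,3,4,1,0));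
      ((1,2,2,0),(0,1,2,2,0)); ((1,3,2,0),(0,1,3,2,0));
      ((1,4,2,0),(0,1,4,2,0)); ((2,3,2,0),(0,2,3,2,0));
      ((2,4,2,0),(0,2,4,2,0)); ((3,4,2,0),(0,3,4,2,0));
      ((1,2,3,0),(0,1,2,3,0)); ((1,3,3,0),(0,1,3,3,0));
      ((1,4,3,0),(0,1,4,3,0)); ((2,3,3,0),(0,2,3,3,0));
      ((2,4,3,0),(0,2,4,3,0)); ((3,4,3,0),(0,3,4,3,0));
      ((2,3,0,0),(1,2,3,2,0)); ((2,4,0,0),(1,2,4,2,0));
      ((3,4,0,0),(1,3,4,2,0)); ((0,2,2,0),(0,1,2,0,0));
      ((0,3,2,0),(0,1,3,0,0)); ((0,4,2,0),(0,1,4,0,0));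
      ((1,2,0,0),(1,2,3,1,0)); ((1,4,0,0),(1,3,4,1,0));
      ((0,2,1,0),(0,2,3,0,0)); ((0,4,1,0),(0,3,4,0,0));
      ((1,3,0,0),(1,3,4,3,0)); ((0,2,3,0),(0,2,4,0,0))]%N.

Definition pivots2 : seq pivot :=
  [:: ((1,3,1,1),(0,1,3,1,1)); ((2,4,1,1),(0,2,4,1,1));
      ((3,4,1,1),(2,3,4,0,0)); ((1,4,1,2),(1,3,4,1,0));
      ((1,4,2,1),(1,3,4,0,1)); ((1,3,2,2),(0,1,3,2,2));
      ((2,3,2,2),(1,2,3,0,0)); ((2,4,2,2),(0,2,4,2,2));
      ((1,4,1,1),(1,2,4,0,0)); ((2,3,1,2),(2,3,4,0,2));
      ((2,3,2,1),(2,3,4,2,0)); ((3,4,2,2),(1,3,4,0,0));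
      ((1,3,0,0),(1,2,3,1,1)); ((2,4,0,0),(1,2,4,2,2));
      ((1,2,0,2),(1,2,4,1,2)); ((1,2,1,0),(1,2,3,1,2));
      ((1,2,0,1),(1,2,3,2,1)); ((1,4,0,0),(1,2,4,1,1));
      ((1,2,2,0),(1,2,4,2,1)); ((2,3,0,0),(1,2,3,2,2));
      ((0,2,0,0),(0,1,2,2,2)); ((0,3,0,0),(0,2,3,1,1));
      ((0,4,0,0),(0,1,4,2,2)); ((0,2,0,2),(0,1,2,2,0));
      ((2,4,1,2),(0,2,4,1,2)); ((0,2,2,0),(0,1,2,0,2));
      ((2,4,2,1),(0,2,4,2,1)); ((0,3,2,2),(0,1,3,0,0));
      ((0,4,2,2),(0,1,4,0,0)); ((0,1,0,0),(0,1,2,1,1));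
      ((0,1,0,1),(0,1,2,1,0)); ((1,3,2,1),(0,1,3,2,1));
      ((0,1,1,0),(0,1,2,0,1)); ((1,3,1,2),(0,1,3,1,2));
      ((0,3,1,1),(0,2,3,0,0)); ((0,4,1,1),(0,2,4,0,0));
      ((0,2,1,0),(0,2,3,1,2)); ((0,4,1,2),(0,3,4,1,0));
      ((3,4,0,2),(1,3,4,2,0)); ((1,4,2,2),(1,3,4,0,2));
      ((3,4,2,0),(0,3,4,0,1)); ((0,1,2,0),(0,1,4,2,1));
      ((0,2,0,1),(0,2,3,2,1)); ((0,1,0,2),(0,1,4,1,2));
      ((0,3,2,1),(0,3,4,2,0)); ((3,4,0,1),(2,3,4,1,0));
      ((2,3,1,1),(2,3,4,0,1)); ((3,4,1,0),(0,3,4,0,2));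
      ((1,2,1,1),(1,2,4,1,0)); ((3,4,1,2),(0,3,4,0,0));
      ((1,2,2,2),(1,2,3,2,0)); ((1,2,0,0),(0,1,2,1,2));
      ((1,3,0,2),(0,1,3,1,0)); ((1,4,0,2),(0,1,4,1,0));
      ((2,3,1,0),(0,2,3,0,2)); ((2,4,1,0),(0,2,4,0,2));
      ((2,3,0,1),(0,2,3,2,0)); ((2,4,0,1),(0,2,4,2,0));
      ((1,3,2,0),(0,1,3,0,1)); ((1,4,2,0),(0,1,4,0,1));
      ((0,4,0,2),(0,3,4,2,2)); ((0,3,0,1),(0,3,4,1,1));
      ((0,1,1,2),(1,3,4,1,2)); ((1,4,1,0),(1,2,4,0,1));
      ((0,4,2,0),(0,1,4,0,2)); ((1,4,0,1),(0,1,4,2,0));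
      ((0,2,1,2),(2,3,4,1,2)); ((2,3,0,2),(1,2,3,0,2));
      ((0,3,1,0),(0,2,3,1,0)); ((2,3,2,0),(0,2,3,0,1));
      ((2,4,0,2),(1,2,4,2,0)); ((1,3,1,0),(1,2,3,0,1));
      ((1,3,0,1),(1,2,3,1,0)); ((2,4,2,0),(1,2,4,0,2));
      ((0,3,0,2),(0,1,3,2,0)); ((0,3,2,0),(0,1,3,0,2));
      ((0,4,0,1),(0,2,4,1,0)); ((0,4,1,0),(0,2,4,0,1));
      ((3,4,0,0),(1,3,4,2,2)); ((0,2,2,2),(0,1,2,0,0));
      ((1,2,1,2),(0,1,2,2,1)); ((3,4,2,1),(0,3,4,2,1));
      ((1,2,2,1),(2,3,4,2,2)); ((0,1,1,1),(2,3,4,1,1));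
      ((0,1,2,2),(0,3,4,1,2))]%N.

(** Only the image e_0 of a_0 (x) a_0 matters here: the block is the wedge with e_0, injective on
    the e_m /\ e_n with 0 < m < n. *)
Definition pivots3ll : seq pivot :=
  [:: ((1,2,0,0),(0,1,2,0,0)); ((1,3,0,0),(0,1,3,0,0));
      ((1,4,0,0),(0,1,4,0,0)); ((2,3,0,0),(0,2,3,0,0));
      ((2,4,0,0),(0,2,4,0,0)); ((3,4,0,0),(0,3,4,0,0))]%N.

Definition pivots_q3 (big big' : bool) : seq pivot :=
  match big, big' with
  | false, false => pivots3
  | true, false => pivots3r
  | false, true => pivots3l
  | true, true => pivots3ll
  end.

(** For d = 0 only the first block exists; the others get an empty certificate. *)
Definition pivots_q2 (big big' : bool) : seq pivot :=
  if big || big' then [::] else pivots2.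

Lemma lower_bound3 (R : realType) (d r : nat) :
  limit_sum_rank_one r (kron (Tcw R (3 + d)) (Tcw R (3 + d))) ->
  ((3 + d + 2) ^ 2 <= r)%N.
Proof.
move/(koszul_lower_bound (f := projection table3) (ps := pivots_q3)).
have -> : size (pivots_q3 false false) = 145%N by [].
have -> : size (pivots_q3 false true) = 30%N by [].
have -> : size (pivots_q3 true false) = 30%N by [].
have -> : size (pivots_q3 true true) = 6%N by [].
suff h : (145 + d * 30 + d * (30 + d * 6) <= 6 * r -> (3 + d + 2) ^ 2 <= r)%N.
  move=> k; apply: h; apply: k.
  - by move=> i i' l; exact: projection_out.
  - by do 2!case.
  - by do 2!case; vm_compute.
by nia.
Qed.

Lemma lower_bound2 (R : realType) (r : nat) :
  limit_sum_rank_one r (kron (Tcw R 2) (Tcw R 2)) -> (15 <= r)%N.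
Proof.
move/(koszul_lower_bound (b := 2) (d := 0) (f := projection table2)
  (ps := pivots_q2)) => h.
have : (85 + 0 * 0 + 0 * (0 + 0 * 0) <= 6 * r)%N.
  apply: h.
  - by move=> i i' l; exact: projection_out.
  - by do 2!case.
  - by do 2!case; vm_compute.
lia.
Qed.

(** * Upper bound *)

Lemma cvg_harmonicC (R : realType) :
  (fun n => n.+1%:R^-1 : R[i]^o) @ \oo --> (0 : R[i]^o).
Proof.
(* A positive element of [R[i]] is real, so the real harmonic sequence can be compared with its real
   part. *)
apply/cvgrPdist_le => /= e; rewrite ltcE => /andP[/eqP /= e0 ep].
have /cvgrPdist_le/(_ _ ep) := @cvg_harmonic R.
apply: filterS => n /=; rewrite !sub0r !normrN => h.
rewrite ger0_norm ?invr_ge0 //.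
have -> : (n.+1%:R^-1 : R[i]) = (n.+1%:R^-1)%:C%C by rewrite fmorphV rmorph_nat.
rewrite lecE /= e0 eqxx /=.
by move: h; rewrite ger0_norm // invr_ge0.
Qed.

Lemma sum_rank_oneI (R : realType) (I J K S : finType)
    (t : S -> tensor R I J K) :
  (forall s, rank_one (t s)) -> sum_rank_one #|S| (\sum_s t s).
Proof.
move=> t1; exists (t \o enum_val) => [s|]; first exact: t1.
by rewrite (reindex (@enum_val S predT)) //; exact/onW_bij/enum_val_bij.
Qed.

Lemma kron_rank_one (R : realType) (I J K I' J' K' : finType)
    (T : tensor R I J K) (T' : tensor R I' J' K') :
  rank_one T -> rank_one T' -> rank_one (kron T T').
Proof.
move=> [a [b [c ->]]] [a' [b' [c' ->]]].
exists [ffun i => a i.1 * a' i.2], [ffun i => b i.1 * b' i.2],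
  [ffun i => c i.1 * c' i.2].
by apply/ffunP => x; rewrite !ffunE /=; ring.
Qed.

(** The product of two sums expands over pairs of indices, and each coordinate of the product is a
    product of coordinates, so limits are preserved. *)
Lemma kron_limit (R : realType) (I J K I' J' K' : finType) (r r' : nat)
    (T : tensor R I J K) (T' : tensor R I' J' K') :
  limit_sum_rank_one r T -> limit_sum_rank_one r' T' ->
  limit_sum_rank_one (r * r') (kron T T').
Proof.
move=> [u ur uT] [u' ur' uT']; exists (fun n => kron (u n) (u' n)) => [n|x].
  case: (ur n) (ur' n) => t t1 -> [t' t1' ->].
  have -> : kron (\sum_(s < r) t s) (\sum_(s < r') t' s)
            = \sum_(s : 'I_r * 'I_r') kron (t s.1) (t' s.2).
    apply/ffunP => x; rewrite !ffunE !sum_ffunE.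
    rewrite mulr_suml -(pair_bigA _ (fun s s' => kron (t s) (t' s') x)) /=.
    apply: eq_bigr => s _; rewrite mulr_sumr.
    by apply: eq_bigr => s' _; rewrite ffunE.
  have -> : (r * r')%N = #|{: 'I_r * 'I_r'}| by rewrite card_prod !card_ord.
  by apply: sum_rank_oneI => s; exact: kron_rank_one.
rewrite ffunE; under eq_fun do rewrite ffunE.
by apply: cvgM; [exact: uT|exact: uT'].
Qed.

(* The Coppersmith-Winograd degeneration: with t = 1/(n+1), T_cw is
   t^-2 sum_j (a_0 + t a_j)(b_0 + t b_j)(c_0 + t c_j)
   - t^-3 (a_0 + t^2 sum_j a_j)(b_0 + t^2 sum_j b_j)(c_0 + t^2 sum_j c_j)
   + (t^-3 - q t^-2) a_0 b_0 c_0 + O(t). *)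
Lemma Tcw_limit (R : realType) (q : nat) : limit_sum_rank_one q.+2 (Tcw R q).
Proof.
pose e := @basis_vect R 'I_q.+1.
pose w : vect R 'I_q.+1 := \sum_(s < q) e (lift ord0 s).
pose v (t : R[i]) (x : vect R 'I_q.+1) : vect R 'I_q.+1 :=
  [ffun i => e ord0 i + t * x i].
pose sc (t : R[i]) (x : vect R 'I_q.+1) : vect R 'I_q.+1 := [ffun i => t * x i].
pose U t (o : option (option 'I_q)) := match o with
  | Some (Some s) => let x := v t (e (lift ord0 s)) in tprod (sc (t ^- 2) x) x x
  | Some None => let x := v (t ^+ 2) w in tprod (sc (- t ^- 3) x) x x
  | None => tprod (sc (t ^- 3 - q%:R * t ^- 2) (e ord0)) (e ord0) (e ord0)
  end.
pose h n : R[i] := n.+1%:R^-1.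
exists (fun n => \sum_o U (h n) o).
  move=> n; have -> : q.+2 = #|{: option (option 'I_q)}|.
    by rewrite !card_option card_ord.
  by apply: sum_rank_oneI => -[[s|]|]; do 3!eexists.
move=> x.
(* P and - Q are the coefficients of t and t^3 in the expansion, whose remainder is thus t (P - t^2
   Q). *)
pose P := (\sum_(s < q)
    tprod (e (lift ord0 s)) (e (lift ord0 s)) (e (lift ord0 s))
  - tprod (e ord0) w w - tprod w (e ord0) w - tprod w w (e ord0)) x.
pose Q := tprod w w w x.
suff limE t : t != 0 -> (\sum_o U t o) x = Tcw R q x + t * (P - t ^+ 2 * Q).
  have h0 n : h n != 0 by rewrite invr_eq0 pnatr_eq0.
  under eq_fun do rewrite limE //.
  have hc : (fun n => h n : R[i]^o) @ \oo --> (0 : R[i]^o) := @cvg_harmonicC R.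
  have lim (a b c : R[i]) : (fun n => a + h n * (b - h n * h n * c) : R[i]^o)
      @ \oo --> (a : R[i]^o).
    rewrite -[X in _ --> X]addr0.
    rewrite -[X in _ --> X](congr1 (+%R a) (mul0r (b - 0 * 0 * c))).
    apply: cvgD; first exact: cvg_cst.
    apply: cvgM; first exact: hc.
    apply: cvgB; first exact: cvg_cst.
    by apply: cvgM; [apply: cvgM; exact: hc|exact: cvg_cst].
  exact: lim.
move=> t0; rewrite {}/P {}/Q; case: x => [[i j] k].
pose a s : R[i] := (i == lift ord0 s)%:R; pose a0 : R[i] := (i == ord0)%:R.
pose b s : R[i] := (j == lift ord0 s)%:R; pose b0 : R[i] := (j == ord0)%:R.
pose c s : R[i] := (k == lift ord0 s)%:R; pose c0 : R[i] := (k == ord0)%:R.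
have wE (i' : 'I_q.+1) : w i' = \sum_(s < q) (i' == lift ord0 s)%:R.
  by rewrite /w sum_ffunE; apply: eq_bigr => s _; rewrite ffunE.
have TE : Tcw R q (i, j, k)
          = \sum_(s < q) (a0 * b s * c s + a s * b0 * c s + a s * b s * c0).
  by rewrite /Tcw sum_ffunE; apply: eq_bigr => s _; rewrite !ffunE.
have DE : (\sum_(s < q) tprod (e (lift ord0 s)) (e (lift ord0 s))
    (e (lift ord0 s))) (i, j, k) = \sum_(s < q) a s * b s * c s.
  by rewrite sum_ffunE; apply: eq_bigr => s _; rewrite !ffunE.
have UssE s : U t (Some (Some s)) (i, j, k)
              = t ^- 2 * (a0 + t * a s) * (b0 + t * b s) * (c0 + t * c s).
  by rewrite !ffunE.
have UsE : U t (Some None) (i, j, k)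
    = - t ^- 3 * (a0 + t ^+ 2 * w i) * (b0 + t ^+ 2 * w j)
      * (c0 + t ^+ 2 * w k).
  by rewrite /U /sc /v !ffunE.
have UnE : U t None (i, j, k) = (t ^- 3 - q%:R * t ^- 2) * a0 * b0 * c0.
  by rewrite /U /sc !ffunE.
(* The terms in t^-2 and t^-1 are isolated because the two other kinds of summands cancel them. *)
have sumE :
    \sum_(s < q) t ^- 2 * (a0 + t * a s) * (b0 + t * b s) * (c0 + t * c s)
    = q%:R * (t ^- 2 * a0 * b0 * c0) + \sum_(s < q) a s * (t^-1 * b0 * c0)
      + \sum_(s < q) b s * (t^-1 * a0 * c0)
      + \sum_(s < q) c s * (t^-1 * a0 * b0) + Tcw R q (i, j, k)
      + t * \sum_(s < q) a s * b s * c s.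
  rewrite TE mulr_natl -[X in _ *+ X](card_ord q) -sumr_const mulr_sumr.
  by rewrite -!big_split; apply: eq_bigr => s _ /=; field.
rewrite sum_ffunE !big_option UnE UsE (eq_bigr _ (fun s _ => UssE s)) sumE.
rewrite -!mulr_suml.
have -> : (\sum_(s < q)
    tprod (e (lift ord0 s)) (e (lift ord0 s)) (e (lift ord0 s))
  - tprod (e ord0) w w - tprod w (e ord0) w - tprod w w (e ord0)) (i, j, k)
  = \sum_(s < q) a s * b s * c s - a0 * w j * w k - w i * b0 * w k
    - w i * w j * c0.
  by rewrite !ffunE DE /=.
rewrite [tprod w w w _]ffunE /= !wE -/(\sum_(s < q) a s).
move: (\sum_(s < q) a s * b s * c s) (Tcw R q (i, j, k)) => D T.
rewrite -/(\sum_(s < q) b s) -/(\sum_(s < q) c s).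
move: (\sum_(s < q) a s) (\sum_(s < q) b s) (\sum_(s < q) c s) => A B C.
by field.
Qed.

Lemma border_rank_limit (R : realType) (I J K : finType) (T : tensor R I J K) :
  limit_sum_rank_one (border_rank T) T.
Proof. by rewrite /border_rank; case: ex_minnP => r /asboolP. Qed.

Lemma border_rank_le (R : realType) (I J K : finType) (r : nat)
    (T : tensor R I J K) :
  limit_sum_rank_one r T -> (border_rank T <= r)%N.
Proof.
by rewrite /border_rank => Tr; case: ex_minnP => m _; apply; apply/asboolP.
Qed.

Local Close Scope ring_scope.
Local Close Scope classical_set_scope.

Theorem theorem2p1 (R : realType) :
  (forall q : nat, (2 < q)%N ->
     border_rank (kron (Tcw R q) (Tcw R q)) = ((q + 2) ^ 2)%N)
  /\ (15 <= border_rank (kron (Tcw R 2) (Tcw R 2)) <= 16)%N.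
Proof.
have upper q : (border_rank (kron (Tcw R q) (Tcw R q)) <= (q + 2) ^ 2)%N.
  by rewrite addn2; apply/border_rank_le/kron_limit; exact: Tcw_limit.
split=> [q q3|].
  (* Writing q as 3 + (q - 3) gives the form b + d with b = 3. *)
  apply/eqP; rewrite eqn_leq upper -(subnKC q3).
  exact/lower_bound3/border_rank_limit.
by rewrite (upper 2) andbT; exact/lower_bound2/border_rank_limit.
Qed.
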